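(* Let $N\ge1$, let $-1\le x_0<x_1<\cdots<x_N\le1$, and let $\omega\in L^1(-1,1)$ satisfy $\omega(x)>0$ for almost every $x\in(-1,1)$. Let $\mathcal S=\{s_1,\ldots,s_N\}$ be a family of intervals whose endpoints belong to the grid $\{x_0,\ldots,x_N\}$: for each $i=1,\ldots,N$ there are integers $0\le k_i<r_i\le N$ with $s_i=[x_{k_i},x_{r_i}]$. Define the matrix $A_{\mathcal S}=[A_{ij}]_{i,j=1}^N$ by $A_{ij}=1$ if $k_i<j\le r_i$ and $A_{ij}=0$ otherwise (equivalently, $A_{ij}=1$ if and only if $[x_{j-1},x_j]\subseteq s_i$). Then $\mathcal S$ is $\omega$-admissible if and only if $\det(A_{\mathcal S})\ne0$.
   Context: $\Pi_{n}$ is the space of real univariate polynomials of degree at most $n$. The family $\mathcal S=\{s_1,\ldots,s_N\}$ is called $\omega$-admissible if the linear map $\Pi_{N-1}\to\mathbb R^N$, $q\mapsto\left[\int_{s_1}q\,\omega\,dx,\ldots,\int_{s_N}q\,\omega\,dx\right]^\top$, is an isomorphism. *)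

(* Defs.v *)
From HB Require Import structures.
From mathcomp Require Import all_boot all_order all_algebra.
From mathcomp Require Import all_classical all_reals all_analysis.

Set Implicit Arguments.
Unset Strict Implicit.
Unset Printing Implicit Defensive.

Import Order.TTheory GRing.Theory Num.Theory.
Import numFieldNormedType.Exports.

Local Open Scope classical_set_scope.
Local Open Scope ring_scope.

(* [{poly_N R}] bounds the size, i.e. 1 + degree, so it is the space of
   polynomials of degree at most N - 1 when N > 0.  The weight [omega] is a
   representative of a class of functions modulo equality almost everywhere:
   its value at a single point, e.g. at -1 or 1, does not affect the integrals. *)
Definition moment_map (R : realType) (N : nat) (omega : R -> R)
    (s : 'I_N -> set R) (q : {poly_N R}) : 'cV[R]_N :=
  \col_(i < N) \int[lebesgue_measure]_(x in s i) ((q : {poly R}).[x] * omega x).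

(* [linear] is part of the definition because [moment_map] is a bare function:
   for a weight that is not integrable the real-valued integral need not be
   additive. *)
Definition admissible (R : realType) (N : nat) (omega : R -> R)
    (s : 'I_N -> set R) : Prop :=
  linear (moment_map omega s) /\ bijective (moment_map omega s).

Definition segments (R : realType) (N : nat) (x : 'I_N.+1 -> R)
    (k r : 'I_N -> 'I_N.+1) (i : 'I_N) : set R :=
  `[x (k i), x (r i)]%classic.

(* The column [j : 'I_N], counted from 0, stands for the (j+1)-st cell
   [x_j, x_(j+1)] of the grid. *)
Definition incidence_mx (R : realType) (N : nat) (k r : 'I_N -> 'I_N.+1) :
    'M[R]_N :=
  \matrix_(i < N, j < N) (if (k i < j.+1 <= r i)%N then 1 else 0).

Lemma incidence_mxE (R : realType) (N : nat) (x : 'I_N.+1 -> R)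
    (k r : 'I_N -> 'I_N.+1)
    (xmono : forall a b : 'I_N.+1, (a < b)%N -> x a < x b) (i j : 'I_N) :
  incidence_mx R k r i j = 1 <->
  `[x (widen_ord (leqnSn N) j), x (lift ord0 j)]%classic `<=` segments x k r i.
Proof.
have xle (a b : 'I_N.+1) : (x a <= x b) = (a <= b)%N.
  case: (ltngtP a b) => [ab|ba|/val_inj ->]; last by rewrite lexx.
    by rewrite ltW // xmono.
  by apply/negbTE; rewrite -ltNge xmono.
have xj : x (widen_ord (leqnSn N) j) <= x (lift ord0 j).
  by rewrite xle /= /bump leq0n add1n leqnSn.
rewrite /segments mxE; split.
  case: ifP => [/andP[kj jr] _ y|_ /eqP]; last by rewrite eq_sym oner_eq0.
  rewrite /= !in_itv /= => /andP[y1 y2]; apply/andP; split.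
    by apply: le_trans y1; rewrite xle.
  by apply: le_trans y2 _; rewrite xle /= /bump leq0n add1n.
move=> sub.
have := sub (x (widen_ord (leqnSn N) j)); rewrite /= !in_itv /= lexx xj.
move=> /(_ isT)/andP[+ _]; rewrite xle /= => kj.
have := sub (x (lift ord0 j)); rewrite /= !in_itv /= lexx xj.
move=> /(_ isT)/andP[_]; rewrite xle /= /bump leq0n add1n => jr.
by rewrite ltnS kj jr.
Qed.

(* Main.v *)
(* Integrating over a segment sums the integrals over the cells it covers, so
   the moment map is A composed with the map G taking q to its cell moments.
   If G q = 0 then, as omega > 0 almost everywhere, q cannot keep a strict sign
   on an open cell, so it has a root in each of the N cells and vanishes.  G is
   thus injective, and by dimension count only A decides whether A G is bijective. *)

Require Import Defs.
From HB Require Import structures.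
From mathcomp Require Import all_boot all_order all_algebra.
From mathcomp Require Import all_classical all_reals all_analysis.
From mathcomp Require Import measurable_realfun.

Set Implicit Arguments.
Unset Strict Implicit.
Unset Printing Implicit Defensive.

Import Order.TTheory GRing.Theory Num.Theory.
Import numFieldNormedType.Exports.

Local Open Scope classical_set_scope.
Local Open Scope ring_scope.

(** Rank-nullity: a trivial kernel gives the image the dimension of [U], hence that of [V], so the
    image is everything. *)
Lemma linear_inj_bij (K : fieldType) (U V : vectType K) (f : {linear U -> V}) :
  \dim {: U} = \dim {: V} -> injective f -> bijective f.
Proof.
move=> dimUV inj_f.
have fE v : linfun f v = f v by rewrite lfunE.
have ker_f : lker (linfun f) == 0%VS by apply/lker0P => u v; rewrite !fE => /inj_f.
have img_f : limg (linfun f) = fullv.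
  apply/eqP; rewrite eqEdim subvf limg_dim_eq ?(eqP ker_f) ?capv0 //.
  by rewrite dimUV leqnn.
exists (linfun f)^-1%VF => [u|v]; rewrite -fE; first exact: lker0_lfunK.
by rewrite limg_lfunVK // img_f memvf.
Qed.

Lemma poly_same_sign (R : rcfType) (p : {poly R}) (a b : R) :
  (forall c, a < c < b -> ~~ root p c) ->
  forall s t, a < s < b -> a < t < b -> 0 < p.[s] * p.[t].
Proof.
move=> noroot s t.
wlog st : s t / s <= t => [hw|].
  by case/orP: (le_total s t) => ? ? ?; last rewrite mulrC; exact: hw.
move=> /andP[s1 s2] /andP[t1 t2].
have ps : p.[s] != 0 by apply: noroot; rewrite s1.
have pt : p.[t] != 0 by apply: noroot; rewrite t1.
rewrite ltNge; apply/negP => le0.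
(* Scaling by [p.[t]] avoids a case split on signs: the values at [s] and [t] become [p.[t] * p.[s]
   <= 0] and a square, as the intermediate value theorem requires. *)
have [|c /andP[sc ct]] := @poly_ivt _ (p.[t] *: p) s t st.
  by rewrite !hornerZ mulrC le0 -expr2 sqr_ge0.
rewrite rootZ //; apply/negP/noroot.
by rewrite (lt_le_trans s1 sc) (le_lt_trans ct t2).
Qed.

(** Almost everywhere on [D], [f] equals its absolute value, whose integral is then 0. So [f] is
    both zero and positive at almost every point of [D], and almost no point lies in [D]. *)
Lemma ae_gt0_Rintegral_eq0 d (T : measurableType d) (R : realType)
    (mu : {measure set T -> \bar R}) (D : set T) (f : T -> R) :
  measurable D -> mu.-integrable D (EFin \o f) ->
  {ae mu, forall t, D t -> 0 < f t} ->
  \int[mu]_(t in D) f t = 0 -> mu D = 0%E.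
Proof.
move=> mD intf f_gt0 intf0.
have mf := measurable_int _ intf.
(* A real-valued integral equal to 0 could stand for an infinite one; integrability excludes
   this. *)
have int0 : (\int[mu]_(t in D) (f t)%:E = 0)%E.
  rewrite -(fineK (integrable_fin_num mD intf)).
  by rewrite -[fine _]/(\int[mu]_(t in D) f t) intf0.
have : (\int[mu]_(t in D) `|(EFin \o f) t| = 0)%E.
  rewrite -int0; apply: ae_eq_integral => //; first exact: measurableT_comp.
  by apply: filterS f_gt0 => t ft Dt /=; rewrite gtr0_norm // ft.
move=> /(ae_eq_integral_abs _ mD mf) f0.
have : {ae mu, forall t, ~ D t}.
  apply: filterS2 f_gt0 f0 => t ft f0t Dt.
  by have := ft Dt; case: (f0t Dt) => ->; rewrite ltxx.
move=> [B [mB B0 DB]]; apply: subset_measure0 B0 => // t Dt.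
by apply: DB => /=; apply.
Qed.

Section Weighted.
Context (R : realType).
Notation mu := (@lebesgue_measure R).

(** The endpoints form a null set. This is needed because the weight is assumed integrable on an
    open interval, while the segments are closed and may reach its ends. *)
Lemma integrable_itv_cc (f : R -> R) (a b : R) :
  mu.-integrable `]a, b[ (EFin \o f) -> mu.-integrable `[a, b] (EFin \o f).
Proof.
move=> /integrableP[mf intf]; apply/integrableP; split.
  exact: (emeasurable_fun_itv_cc mf).
by rewrite integral_itv_bndoo //; exact: measurableT_comp.
Qed.

(** A polynomial is measurable and bounded on a bounded interval. *)
Lemma integrable_horner_mul (p : {poly R}) (w : R -> R) (a b : R) :
  mu.-integrable `]a, b[ (EFin \o w) ->
  mu.-integrable `]a, b[ (EFin \o (fun t => p.[t] * w t)).
Proof.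
move=> intw.
apply: (@integrableMr _ _ _ mu _ _ (horner p) (EFin \o w)) => //.
  apply: measurable_funTS; apply: continuous_measurable_fun.
  exact: continuous_horner.
have [M pM] := poly_itv_bound p a b.
exists M; split; first exact: num_real.
move=> y My t /=; rewrite in_itv /= => /andP[at_ tb].
by rewrite (le_trans (pM _ _) (ltW My)) // !ltW.
Qed.

Lemma Rintegral_itv_split (f : R -> R) (a c d b : R) :
  mu.-integrable `[a, b] (EFin \o f) -> a <= c -> c <= d -> d <= b ->
  \int[mu]_(t in `[c, d]) f t =
  \int[mu]_(t in `[a, d]) f t - \int[mu]_(t in `[a, c]) f t.
Proof.
move=> intf ac cd db.
have sub (I : interval R) : (I <= `[a, b])%O -> mu.-integrable [set` I] (EFin \o f).
  move=> Iab; apply: integrableS intf => // t /=; exact: subitvP.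
(* The subtraction leaves []c, d]], which differs from [[c, d]] by a null point. *)
rewrite Rintegral_itvB ?bnd_simp // ?Rintegral_itv_obnd_cbnd //.
all: by apply: sub; rewrite subitvE !bnd_simp ?ac ?db ?(le_trans ac cd).
Qed.

Lemma root_of_moment_eq0 (p : {poly R}) (w : R -> R) (a b : R) :
  a < b -> mu.-integrable `]a, b[ (EFin \o w) ->
  {ae mu, forall t, `]a, b[%classic t -> 0 < w t} ->
  \int[mu]_(t in `[a, b]) (p.[t] * w t) = 0 ->
  exists2 c, a < c < b & root p c.
Proof.
move=> ab intw w_gt0 int0; apply: contrapT => noroot.
have {}noroot c : a < c < b -> ~~ root p c.
  by move=> cab; apply/negP => pc; apply: noroot; exists c.
have ptp := poly_same_sign noroot.
have mab : a < (a + b) / 2 < b by rewrite !midf_lt.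
(* Any interior point would do: without roots, [p.[m] *: p] is positive on the whole of []a, b[],
   whatever the sign of [p]. Its weighted integral is still 0, which would make []a, b[] a null
   set. *)
set m := (a + b) / 2 in mab.
suff /eqP : mu `]a, b[ = 0%E.
  by rewrite lebesgue_measure_itv /= lte_fin ab -EFinD eqe subr_eq0 gt_eqF.
have intpw := integrable_horner_mul (p.[m] *: p) intw.
apply: (ae_gt0_Rintegral_eq0 _ intpw) => //.
  apply: (@filterS _ _ (ae_filter_ringOfSetsType mu)) w_gt0 => t wt tab.
  rewrite hornerZ mulr_gt0 ?wt //.
  by apply: ptp => //; move: tab; rewrite /= in_itv.
have -> : \int[mu]_(t in `]a, b[) ((p.[m] *: p).[t] * w t) =
          p.[m] * \int[mu]_(t in `]a, b[) (p.[t] * w t).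
  rewrite -RintegralZl //; last exact: integrable_horner_mul.
  by apply: eq_Rintegral => t _; rewrite hornerZ mulrA.
suff -> : \int[mu]_(t in `]a, b[) (p.[t] * w t) =
          \int[mu]_(t in `[a, b]) (p.[t] * w t) by rewrite int0 mulr0.
congr fine; apply/esym/integral_itv_bndoo.
exact: measurable_int (integrable_horner_mul p intw).
Qed.

Lemma moment_map_linear N (w : R -> R) (I : 'I_N -> interval R) :
  (forall i (p : {poly R}),
    mu.-integrable [set` I i] (EFin \o (fun t => p.[t] * w t))) ->
  linear (moment_map w (fun i => [set` I i])).
Proof.
move=> intw c p q; apply/colP => i; rewrite !mxE.
have intcp : mu.-integrable [set` I i] (EFin \o (fun t => c * ((p : {poly R}).[t] * w t))).
  rewrite (_ : (fun t => _) = fun t => (c *: (p : {poly R})).[t] * w t); first exact: intw.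
  by apply/funext => t; rewrite hornerZ mulrA.
rewrite -(RintegralZl _ _ (intw i p)) // -(RintegralD _ intcp (intw i q)) //.
apply: eq_Rintegral => t _ /=.
by rewrite hornerD hornerZ mulrDl mulrA.
Qed.
End Weighted.

Section Grid.
Context (R : realType) (N : nat) (x : 'I_N.+1 -> R).
Context (x_mono : forall a b : 'I_N.+1, (a < b)%N -> x a < x b).
Notation mu := (@lebesgue_measure R).

Definition cell (j : 'I_N) : set R :=
  `[x (widen_ord (leqnSn N) j), x (lift ord0 j)]%classic.

Lemma grid_le (a b : 'I_N.+1) : (a <= b)%N -> x a <= x b.
Proof. by rewrite leq_eqVlt => /predU1P[/val_inj -> //|/x_mono /ltW]. Qed.

Lemma Rintegral_segment_cells (f : R -> R) (k r : 'I_N -> 'I_N.+1) (i : 'I_N) :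
  mu.-integrable `[x ord0, x ord_max] (EFin \o f) -> (k i <= r i)%N ->
  \int[mu]_(t in segments x k r i) f t =
  \sum_(j < N) incidence_mx R k r i j * \int[mu]_(t in cell j) f t.
Proof.
move=> intf kr.
(* A primitive of [f] on the grid, indexed by [nat] so that sums of its increments telescope. Only
   indices up to [N] occur, so the default value of [inord] is never met. *)
pose F (n : nat) := \int[mu]_(t in `[x ord0, x (inord n)]) f t.
have FE (a b : 'I_N.+1) : (a <= b)%N ->
    \int[mu]_(t in `[x a, x b]) f t = F b - F a.
  move=> ab; rewrite /F !inord_val.
  by apply: (Rintegral_itv_split intf); apply: grid_le => //; rewrite -ltnS ltn_ord.
(* The sum over [k i <= j < r i] is extended to all [j < N]; the range becomes a condition on [j],
   which is the incidence condition since [k i < j.+1] means [k i <= j]. *)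
rewrite /segments FE // -telescope_sumr // (big_nat_widen _ _ N) ?(ltnSE (ltn_ord _)) //.
rewrite big_geq_mkord big_mkcond /=; apply: eq_bigr => j _.
rewrite mxE ltnS /cell FE /= /bump leq0n ?add1n // andbC.
by case: ifP; rewrite ?mul1r ?mul0r.
Qed.

Lemma cell_moments_inj (w : R -> R) :
  mu.-integrable `]x ord0, x ord_max[ (EFin \o w) ->
  {ae mu, forall t, `]x ord0, x ord_max[%classic t -> 0 < w t} ->
  forall q : {poly_N R}, moment_map w cell q = 0 -> q = 0.
Proof.
move=> intw w_gt0 q mq0.
have sub j : `]x (widen_ord (leqnSn N) j), x (lift ord0 j)[ `<=` `]x ord0, x ord_max[.
  move=> t /=; apply: subitvP; rewrite subitvE !bnd_simp.
  by rewrite !grid_le // -ltnS ltn_ord.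
have rootE j : exists c, x (widen_ord (leqnSn N) j) < c < x (lift ord0 j) /\ root q c.
  have [||||c] := @root_of_moment_eq0 R q w (x (widen_ord (leqnSn N) j)) (x (lift ord0 j)).
  - by apply: x_mono; rewrite /= /bump add1n.
  - by apply: integrableS intw => //; exact: sub.
  - by apply: (@filterS _ _ (ae_filter_ringOfSetsType mu)) w_gt0 => t wt /sub.
  - by move/colP/(_ j): mq0; rewrite !mxE.
  by move=> cj qc; exists c.
have [c cP] := choice rootE.
(* Neighbouring cells share a grid point, but the roots lie strictly inside their cells, so they are
   distinct. *)
have c_lt (i j : 'I_N) : (i < j)%N -> c i < c j.
  move=> ij; have [/andP[_ ci] _] := cP i; have [/andP[cj _] _] := cP j.
  by apply: lt_trans cj; apply: (lt_le_trans ci); apply: grid_le; rewrite /= /bump add1n.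
have c_inj : injective c.
  move=> i j cij; apply: val_inj; case: (ltngtP i j) => // /c_lt.
    by rewrite cij ltxx.
  by rewrite cij ltxx.
apply/val_inj/eqP/negPn/negP => /= q0.
have roots_c : all (root q) [seq c i | i : 'I_N].
  by apply/allP => _ /mapP[i _ ->]; case: (cP i).
(* A nonzero polynomial with [N] distinct roots has size greater than [N], against the bound in
   [{poly_N R}]. *)
have := max_poly_roots q0 roots_c.
rewrite map_inj_uniq ?enum_uniq // size_map -cardT card_ord => /(_ isT).
by rewrite ltnNge size_npoly.
Qed.
End Grid.

Theorem theorem2 (R : realType) (N : nat) (hN : (1 <= N)%N)
    (x : 'I_N.+1 -> R)
    (hx0 : -1 <= x ord0)
    (hxmono : forall a b : 'I_N.+1, (a < b)%N -> x a < x b)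
    (hxN : x ord_max <= 1)
    (omega : R -> R)
    (homegaL1 : lebesgue_measure.-integrable `]-1, 1[ (EFin \o omega))
    (homega_pos : {ae lebesgue_measure,
                    forall t : R, `]-1, 1[%classic t -> 0 < omega t})
    (k r : 'I_N -> 'I_N.+1)
    (hkr : forall i : 'I_N, (k i < r i)%N) :
  admissible omega (segments x k r) <-> \det (incidence_mx R k r) != 0.
Proof.
set A := incidence_mx R k r; set mu := @lebesgue_measure R.
have sub : `]x ord0, x ord_max[ `<=` `]-1, 1[.
  by move=> t /=; apply: subitvP; rewrite subitvE !bnd_simp hx0 hxN.
have intw : mu.-integrable `]x ord0, x ord_max[ (EFin \o omega).
  by apply: integrableS homegaL1 => //; exact: sub.
have w_gt0 : {ae mu, forall t, `]x ord0, x ord_max[%classic t -> 0 < omega t}.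
  by apply: (@filterS _ _ (ae_filter_ringOfSetsType mu)) homega_pos => t wt /sub.
have x_le := grid_le hxmono.
have intpw (p : {poly R}) :
    mu.-integrable `[x ord0, x ord_max] (EFin \o (fun t => p.[t] * omega t)).
  exact/integrable_itv_cc/integrable_horner_mul.
have momentE q : moment_map omega (segments x k r) q = A *m moment_map omega (cell x) q.
  apply/colP => i; rewrite mxE [RHS]mxE.
  rewrite [LHS](Rintegral_segment_cells hxmono (intpw q) (ltnW (hkr i))).
  by apply: eq_bigr => j _; rewrite [moment_map _ _ _ _ _]mxE.
have lin : linear (moment_map omega (segments x k r)).
  apply: moment_map_linear => i p; apply: integrableS (intpw p) => // t /=.
  by apply: subitvP; rewrite subitvE !bnd_simp !x_le // -ltnS ltn_ord.
split=> [[_ [g _ gK]]|detA].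
  (* Only surjectivity is used: each basis vector is [A] times some vector of cell moments, so
     [v *m A = 0] forces every coordinate of [v] to vanish. *)
  apply/det0P => -[v v0 vA]; move/eqP: v0; apply.
  apply/rowP => j; have := congr1 (fun b => (v *m b) 0 0) (gK (delta_mx j 0)).
  by rewrite momentE mulmxA vA mul0mx -colE !mxE => <-.
split => //.
pose F : {linear {poly_N R} -> 'cV[R]_N} := HB.pack (moment_map omega (segments x k r))
  (GRing.isLinear.Build _ _ _ _ _ lin).
apply: (@linear_inj_bij _ _ _ F).
  by rewrite dim_polyn dimvf /dim /= muln1.
apply: raddf_inj => q /=; rewrite momentE => Aq0.
apply: (cell_moments_inj hxmono intw w_gt0).
(* Since [A] is invertible, it cancels from [A *m moment_map omega (cell x) q = 0], leaving
   vanishing cell moments. *)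
by rewrite -(mulKmx (_ : A \in unitmx) (moment_map _ _ q)) ?Aq0 ?mulmx0 // unitmxE unitfE.
Qed.
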